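(* Let $\mathcal{A}=\{H_i\}_{i\in I}$ be a finite set of affine hyperplanes in $V=\mathbb{R}^n$ (not necessarily central), let $\mathcal{D}$ be a convex set of chambers of $\mathcal{A}$, say $\mathcal{D}=\{C : \sigma_i(C)=+ \text{ for all } i\in J\}\neq\emptyset$ with $J\subseteq I$, and let $\mathcal{G}$ (the semigroup of faces of chambers in $\mathcal{D}$) and $\mathcal{M}_0$ (the set of supports of the faces $G\in\mathcal{G}$ with $\sigma_i(G)=+$ for all $i\in J$) be defined as in the context. For any probability distribution $\{w_G\}_{G\in\mathcal{G}}$ on $\mathcal{G}$, the transition matrix $$P(D,D')=\sum_{G\in\mathcal{G},\ GD=D'} w_G\qquad (D,D'\in\mathcal{D})$$ of the random walk on $\mathcal{D}$ is diagonalizable. It has an eigenvalue $$\lambda_X=\sum_{G\in\mathcal{G},\ G\subseteq X} w_G$$ for each $X\in\mathcal{M}_0$, with multiplicity $|\mu(X,V)|$.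
   Context: For each $i\in I$ let $H_i^+,H_i^-$ be the two open halfspaces determined by $H_i$ (the choice of sign is arbitrary but fixed) and $H_i^0=H_i$. A face of $\mathcal{A}$ is a nonempty set $F=\bigcap_{i\in I}H_i^{\sigma_i}$ with $\sigma_i\in\{+,-,0\}$; the sign sequence of $F$ is $\sigma(F)=(\sigma_i(F))_{i\in I}$. Chambers are the faces with $\sigma_i\neq 0$ for all $i$. The set $\mathcal{F}$ of faces is ordered by $F\le G$ iff for each $i$ either $\sigma_i(F)=0$ or $\sigma_i(F)=\sigma_i(G)$, and it is a semigroup: $FG$ is the face with $\sigma_i(FG)=\sigma_i(F)$ if $\sigma_i(F)\ne0$ and $\sigma_i(FG)=\sigma_i(G)$ if $\sigma_i(F)=0$. The support of $F$ is $\operatorname{supp}F=\bigcap_{\sigma_i(F)=0}H_i$. A nonempty set $\mathcal{D}$ of chambers is convex if it is the set of chambers contained in an intersection of some of the halfspaces determined by $\mathcal{A}$; after renaming halfspaces there is $J\subseteq I$ with $\mathcal{D}=\{C \text{ chamber}:\sigma_i(C)=+\text{ for all }i\in J\}$. Set $\mathcal{G}=\{G\in\mathcal{F}:\sigma_i(G)\in\{0,+\}\text{ for all }i\in J\}$; this is the set of all faces of chambers in $\mathcal{D}$, and it is a subsemigroup of $\mathcal{F}$ with $GD\in\mathcal{D}$ for $G\in\mathcal{G}$, $D\in\mathcal{D}$. Set $\mathcal{G}_0=\{G\in\mathcal{G}:\sigma_i(G)=+\text{ for all }i\in J\}$. Let $\mathcal{L}$ be the intersection semilattice of $\mathcal{A}$: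 all nonempty affine subspaces of the form $\bigcap_{H\in\mathcal{A}'}H$ with $\mathcal{A}'\subseteq\mathcal{A}$ (including $V$), ordered by inclusion (so $V$ is the largest element). $\mathcal{M}_0\subseteq\mathcal{L}$ is the set of supports of faces in $\mathcal{G}_0$; equivalently, the set of $X\in\mathcal{L}$ that meet the open set $U=\bigcap_{i\in J}H_i^+$. $\mu$ is the Möbius function of the poset $\mathcal{L}$ (for $X\in\mathcal{M}_0$ every $Y\in\mathcal{L}$ with $Y\ge X$ is in $\mathcal{M}_0$, so $\mu(X,V)$ may equally be computed in $\mathcal{M}_0$). Multiplicity convention: the eigenvalues of $P$, counted with multiplicity, are the numbers $\lambda_X$ ($X\in\mathcal{M}_0$), each listed $|\mu(X,V)|$ times; multiplicities of coinciding values add. *)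

(* Defs.v *)
From HB Require Import structures.
From mathcomp Require Import all_boot all_order all_algebra.
From mathcomp Require Import all_classical reals.

Set Implicit Arguments.
Unset Strict Implicit.
Unset Printing Implicit Defensive.

Import Order.TTheory GRing.Theory Num.Theory.

Local Open Scope classical_set_scope.
Local Open Scope ring_scope.

Section Mobius.
Context {d : Order.disp_t} {T : finPOrderType d}.
Implicit Types x y z : T.

(* The first argument is recursion fuel; #|T| is always enough, see
   mobiusE. *)
Fixpoint mobius_rec (k : nat) (x y : T) : int :=
  if k is k'.+1 then
    if x == y then 1 else - \sum_(z : T | (x <= z < y)%O) mobius_rec k' x z
  else 0.

Definition mobius (x y : T) : int := mobius_rec #|T| x y.

Let below y := [set z : T | (z <= y)%O]%SET.

Let card_below y z : (z < y)%O -> (#|below z| < #|below y|)%N.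
Proof.
move=> zy; apply: proper_card; apply/properP; split.
  by apply/fintype.subsetP => t; rewrite !inE => /le_trans -> //; exact: ltW.
by exists y; rewrite !inE // lt_geF.
Qed.

Let mobius_rec_stable k k' x y :
  (#|below y| <= k)%N -> (#|below y| <= k')%N ->
  mobius_rec k x y = mobius_rec k' x y.
Proof.
elim: k k' y => [|k IH] [|k'] y //= => [|/[swap]|].
- by rewrite leqn0 => /eqP/cards0_eq/setP/(_ y); rewrite !inE lexx.
- by rewrite leqn0 => /eqP/cards0_eq/setP/(_ y); rewrite !inE lexx.
move=> yk yk'; case: eqP => // _; congr (- _).
apply: eq_bigr => z /andP[_ zy].
by apply: IH; rewrite -ltnS; apply: leq_trans (card_below zy) _.
Qed.

Lemma mobiusE x y : mobius x y =
  if x == y then 1 else - \sum_(z : T | (x <= z < y)%O) mobius x z.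
Proof.
have Tge z : (#|below z| <= #|T|)%N by exact: max_card.
by rewrite {1}/mobius (@mobius_rec_stable _ #|T|.+1) //; exact: leqW.
Qed.

Lemma sum_mobius x y : (x <= y)%O ->
  \sum_(z : T | (x <= z <= y)%O) mobius x z = (x == y)%:R.
Proof.
move=> xy; rewrite (bigD1 y) ?xy ?lexx //= [mobius x y]mobiusE.
rewrite (eq_bigl (fun z => (x <= z < y)%O)); last first.
  by move=> z; rewrite lt_neqAle -andbA [(z != y) && _]andbC.
case: eqP => [<-|_]; last by rewrite addNr.
by rewrite big_pred0 ?addr0 // => z; rewrite le_lt_asym.
Qed.

End Mobius.

Inductive sign := Minus | Zero | Plus.

Definition option_of_sign (s : sign) : option bool :=
  match s with Minus => Some false | Zero => None | Plus => Some true end.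

Definition sign_of_option (o : option bool) : sign :=
  match o with Some false => Minus | None => Zero | Some true => Plus end.

Lemma option_of_signK : cancel option_of_sign sign_of_option.
Proof. by case. Qed.

HB.instance Definition _ := Finite.copy sign (can_type option_of_signK).

(* The sign of normal i fixes which of the two open halfspaces bounded by H_i
   is the positive one. *)
Record arrangement (R : realType) (n : nat) (I : finType) := Arrangement {
  normal : I -> 'rV[R]_n;
  offset : I -> R;
  normal_neq0 : forall i, normal i != 0;
  hyperplanes_distinct :
    injective (fun i => [set x : 'rV[R]_n |
      \sum_(j < n) normal i 0 j * x 0 j = offset i])
}.

Section Arrangement.
Context {R : realType} {n : nat} {I : finType}.
Variable A : arrangement R n I.
Local Notation V := 'rV[R]_n.

Definition halfspace (i : I) (s : sign) : set V :=
  match s with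
  | Plus  => [set x | \sum_(j < n) normal A i 0 j * x 0 j > offset A i]
  | Minus => [set x | \sum_(j < n) normal A i 0 j * x 0 j < offset A i]
  | Zero  => [set x | \sum_(j < n) normal A i 0 j * x 0 j = offset A i]
  end.

Definition hyperplane (i : I) : set V := halfspace i Zero.

Definition cell (s : {ffun I -> sign}) : set V := \bigcap_i halfspace i (s i).

(* The sign sequence of a nonempty cell is determined by the cell, so a face
   is encoded by its sign sequence; the point set of the face F is
   cell (signs F). *)
Record face := Face {
  signs :> {ffun I -> sign};
  face_neq0 : `[< cell signs !=set0 >]
}.

HB.instance Definition _ := [isSub for signs].
HB.instance Definition _ := [Finite of face by <:].

Definition is_chamber (F : face) : bool := [forall i, F i != Zero].

Definition smul (s t : {ffun I -> sign}) : {ffun I -> sign} :=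
  [ffun i => if s i == Zero then t i else s i].

(* Start in F and move a small distance towards a point of G. *)
Lemma face_mul_subproof (F G : face) : `[< cell (smul F G) !=set0 >].
Proof.
case: F G => [s /asboolP[x sx]] [t /asboolP[y ty]] /=.
pose f i (z : V) := \sum_(j < n) normal A i 0 j * z 0 j - offset A i.
have fE i u z : halfspace i u z <->
    match u with Plus => 0 < f i z | Minus => f i z < 0 | Zero => f i z = 0 end.
  rewrite /f; case: u => /=; rewrite ?subr_lt0 ?subr_gt0; split=> //.
    by move=> ->; rewrite subrr.
  exact: subr0_eq.
pose e : R := (1 + \sum_i `|f i y - f i x| / `|f i x|)^-1.
have sum_ge0 (P : pred I) : 0 <= \sum_(i | P i) `|f i y - f i x| / `|f i x|.
  by apply: sumr_ge0 => i _; rewrite divr_ge0.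
have e_gt0 : 0 < e by rewrite invr_gt0 ltr_pwDl // sum_ge0.
have fz i : f i (x + e *: (y - x)) = f i x + e * (f i y - f i x).
  rewrite /f [- (_ - offset A i)]opprB addrA subrK addrAC.
  congr (_ - _).
  rewrite -sumrB mulr_sumr -big_split /=; apply: eq_bigr => j _.
  by rewrite !mxE mulrDr mulrCA mulrBr.
have small i : f i x != 0 -> `|e * (f i y - f i x)| < `|f i x|.
  rewrite -normr_gt0 => fx_gt0; rewrite normrM (gtr0_norm e_gt0) mulrC.
  rewrite ltr_pdivrMr; last by rewrite -invr_gt0.
  rewrite mulrC -ltr_pdivrMr // (bigD1 i) //= addrCA ltrDl.
  by rewrite ltr_pwDl // sum_ge0.
apply/asboolP; exists (x + e *: (y - x)) => i _; apply/fE; rewrite fz ffunE.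
have /fE := sx i Logic.I; have /fE := ty i Logic.I.
case si : (s i) => /= ti fix_.
- have /small : f i x != 0 by rewrite lt_eqF.
  rewrite (ltr0_norm fix_) ltr_norml opprK => /andP[_].
  by rewrite -ltrBrDl sub0r.
- rewrite fix_ add0r subr0; case: (t i) ti => [h|->|h].
  + by rewrite pmulr_rlt0.
  + by rewrite mulr0.
  + by rewrite mulr_gt0.
- have /small : f i x != 0 by rewrite gt_eqF.
  rewrite (gtr0_norm fix_) ltr_norml => /andP[+ _].
  by rewrite -ltrBlDl sub0r.
Qed.

Definition face_mul (F G : face) : face := Face (face_mul_subproof F G).

Lemma face_mulA : associative face_mul.
Proof.
move=> F G H; apply/val_inj/ffunP => i; rewrite !ffunE.
by case E: (F i == Zero) => //=; rewrite E.
Qed.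

HB.instance Definition _ := isSemigroup.Build face face_mulA.

Definition is_flat (X : set V) : Prop :=
  X !=set0 /\ exists B : {set I}, X = \bigcap_(i in [set` B]) hyperplane i.

Record flat := Flat {
  points :> set V;
  flatP : `[< is_flat points >]
}.

HB.instance Definition _ := [isSub for points].
HB.instance Definition _ := [Choice of flat by <:].
HB.instance Definition _ :=
  [SubChoice_isSubPOrder of flat by <: with Order.default_display].

Lemma leflatE (X Y : flat) : (X <= Y)%O = `[< points X `<=` points Y >].
Proof. by []. Qed.

Definition flat_index (X : flat) : {set I} :=
  [set i | `[< points X `<=` hyperplane i >]]%SET.

Definition flat_of_index (B : {set I}) : option flat :=
  insub (\bigcap_(i in [set` B]) hyperplane i).

Lemma flat_indexK : pcancel flat_index flat_of_index.
Proof.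
case=> X HX; rewrite /flat_of_index.
suff -> : \bigcap_(i in [set` flat_index (Flat HX)]) hyperplane i = X.
  by rewrite (insubT (fun X => `[< is_flat X >]) HX).
have /asboolP[_ [B XB]] := HX.
apply/seteqP; split=> x; last first.
  by move=> Xx i /=; rewrite inE => /asboolP; apply.
move=> Hx; rewrite [X in X x]XB => i /= iB; apply: Hx => /=; rewrite inE.
by apply/asboolP => y /=; rewrite XB; apply.
Qed.

HB.instance Definition _ : isCountable flat := PCanIsCountable flat_indexK.
HB.instance Definition _ : isFinite flat := PCanIsFinite flat_indexK.

Lemma whole_subproof : `[< is_flat setT >].
Proof.
apply/asboolP; split; first by exists 0.
by exists finset.set0; apply/seteqP; split=> // x _ i /=; rewrite inE.
Qed.

Definition whole : flat := Flat whole_subproof.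

Lemma supp_subproof (F : face) :
  `[< is_flat (\bigcap_(i in [set i | F i = Zero]) hyperplane i) >].
Proof.
apply/asboolP; split.
  have /asboolP[x Fx] := face_neq0 F.
  by exists x => i /= Fi; have := Fx i Logic.I; rewrite Fi.
exists [set i | F i == Zero]%SET; congr bigcap.
by apply/seteqP; split=> i /=; rewrite inE => /eqP.
Qed.

Definition supp (F : face) : flat := Flat (supp_subproof F).

Section Convex.
Variable J : {set I}.

Definition convex_chambers : {set face} :=
  [set C : face | is_chamber C & [forall i in J, C i == Plus]]%SET.

Definition convex_faces : {set face} :=
  [set G : face | [forall i in J, (G i == Zero) || (G i == Plus)]]%SET.

Definition interior_faces : {set face} :=
  [set G in convex_faces | [forall i in J, G i == Plus]]%SET.

Definition interior_flats : {set flat} := (supp @: interior_faces)%SET.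

Variable w : face -> R.

Definition is_distribution : Prop :=
  (forall G, G \in convex_faces -> 0 <= w G) /\
  \sum_(G in convex_faces) w G = 1.

Definition transition : 'M[R]_#|convex_chambers| :=
  \matrix_(D, D')
    \sum_(G in convex_faces | (G * enum_val D)%g == enum_val D') w G.

Definition lambda (X : flat) : R :=
  \sum_(G in convex_faces | `[< cell G `<=` points X >]) w G.

End Convex.
End Arrangement.

(* Main.v *)
Require Import Defs.
From mathcomp Require Import all_boot all_order all_algebra.
From mathcomp Require Import all_classical reals.
From mathcomp Require Import ring lra.
Import Order.TTheory GRing.Theory Num.Theory.
Local Open Scope ring_scope.

(** The walk acts on functions on the set of chambers by
    [(P f) D = \sum_G w G * f (G D)]. For a set [S] of hyperplanes let [x_S] be
    the function equal to 1 on the chambers lying on the positive side of every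
    member of [S], and to 0 elsewhere. The sign of [G D] at a hyperplane is that
    of [D] if [G] lies on the hyperplane, and is dictated by [G] otherwise, so
    [x_S (G D)] is either 0 or [x_T D], where [T] consists of the members of [S]
    that contain [G]. Hence [P x_S] is a combination of the [x_T] with [T]
    included in [S], and the coefficient of [x_S] itself is the total weight of
    the faces contained in [X_S], the intersection of the hyperplanes in [S].

    The [x_S] are too many to form a basis, but those indexed by the
    no-broken-circuit sets [S] whose [X_S] meets the open cone [U] cut out by
    [J] do form one ([eval_mx_free] and [size_nbcs]). Subsets of such sets are
    again of this kind ([nbc_down]), so [P] is triangular in this basis
    ([transition_eval]) and its characteristic polynomial is the product over
    these [S] of ['X - lambda X_S]. It remains to see that each flat [X] that
    meets [U] is [X_S] for exactly [|mobius X V|] no-broken-circuit sets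
    ([mobius_count]) and for at least one ([interior_flat_nbc], which makes
    [lambda X] an eigenvalue). The first point follows by Moebius inversion from
    an alternating count ([nbc_alternating]), because [#|S|] is the
    codimension of [X_S] ([nbc_rank]), so that all terms have the same sign.

    All the facts on no-broken-circuit sets are proved by deletion and
    restriction: the sets are defined by recursion on a list of hyperplanes
    inside a relatively open convex set [W]; removing the first hyperplane [H]
    of the list splits them into those for [W] and those for [W `&` H].

    Diagonalizability uses that the weights are nonnegative. Every sign vector
    [f] gives a matrix [M f] of its left action on chambers, with [M 0] the
    identity, and [P (M f) = \sum_G w G *: M (f G)]. The faces with [f G = f]
    contribute a scalar multiple of [M f]; for the others of nonzero weight, the
    scalar attached to [f G] is strictly larger than the one attached to [f].
    Multiplying successively by the factors [P - r], for [r] in the finite set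
    of these scalars, thus kills every [M f], in particular the identity: [P] is
    annihilated by a split polynomial with simple roots. *)

Set Implicit Arguments.
Unset Strict Implicit.
Unset Printing Implicit Defensive.

(** * Hyperplanes, segments and relatively open convex sets *)

Section Geometry.
Context {R : realType} {n : nat} {I : finType}.
Variable A : arrangement R n I.
Local Notation V := 'rV[R]_n.
Local Open Scope classical_set_scope.
Implicit Types (i j k : I) (p q r : V) (W Y : set V) (s : seq I) (S T B : {set I}).

Definition aff i p : R := \sum_(j < n) normal A i 0 j * p 0 j - offset A i.

Definition along p q (t : R) : V := p + t *: (q - p).

Lemma aff_along i p q t :
  aff i (along p q t) = aff i p + t * (aff i q - aff i p).
Proof.
rewrite /aff [- (_ - offset A i)]opprB addrA subrK addrAC; congr (_ - _).
rewrite -sumrB mulr_sumr -big_split /=; apply: eq_bigr => j _.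
by rewrite !mxE; ring.
Qed.

Lemma hyperplaneE k p : hyperplane A k p <-> aff k p = 0.
Proof. by rewrite /aff /=; split=> [->|/subr0_eq//]; rewrite subrr. Qed.

(** The bound [e] is uniform because there are finitely many hyperplanes: it is
    smaller than each of the times at which the line could meet one of those
    that avoid [p]. *)
Lemma sg_along_near p q : exists2 e : R, 0 < e &
  forall t, `|t| <= e -> forall i, aff i p != 0 ->
    Num.sg (aff i (along p q t)) = Num.sg (aff i p).
Proof.
pose d i := aff i q - aff i p.
have sum_ge0 (P : pred I) : 0 <= \sum_(i | P i) `|d i| / `|aff i p|.
  by apply: sumr_ge0 => i _; rewrite divr_ge0.
have e_gt0 : 0 < (1 + \sum_i `|d i| / `|aff i p|)^-1.
  by rewrite invr_gt0 ltr_pwDl.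
eexists; first exact: e_gt0.
move=> t te i pi; have pi' : 0 < `|aff i p| by rewrite normr_gt0.
have small : `|t * d i| < `|aff i p|.
  rewrite normrM; apply: le_lt_trans (ler_wpM2r (normr_ge0 _) te) _.
  rewrite mulrC ltr_pdivrMr; last by rewrite -invr_gt0.
  rewrite mulrC -ltr_pdivrMr // (bigD1 i) //= addrCA ltrDl.
  by rewrite ltr_pwDl // sum_ge0.
rewrite aff_along -/(d i); move: pi; rewrite neq_lt => /orP[pi|pi].
  rewrite (ltr0_sg pi) ltr0_sg //.
  by move: small; rewrite (ltr0_norm pi) ltr_norml => /andP[]; lra.
rewrite (gtr0_sg pi) gtr0_sg //.
by move: small; rewrite (gtr0_norm pi) ltr_norml => /andP[]; lra.
Qed.

(** Convexity is the part [0 <= t <= 1]; the extension to [- e <= t] says that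
    [W] is open in its affine span. One condition for both is what deletion and
    restriction needs, and it is stable under intersection with hyperplanes. *)
Definition relopen W := forall p q, W p -> W q ->
  exists2 e : R, 0 < e & forall t, - e <= t <= 1 -> W (along p q t).

Definition on S : set V := [set p | forall i, i \in S -> aff i p = 0].

Lemma relopen_on W S : relopen W -> relopen (W `&` on S).
Proof.
move=> oW p q [Wp Sp] [Wq Sq]; have [e e0 We] := oW p q Wp Wq.
exists e => // t /We Wt; split=> // i iS.
by rewrite aff_along Sp // Sq // subrr mulr0 addr0.
Qed.

Lemma on1 k : on [set k]%SET = hyperplane A k.
Proof.
apply/seteqP; split=> p; first by move=> /(_ k (set11 k)) /hyperplaneE.
by move=> /hyperplaneE pk i /set1P ->.
Qed.

Lemma on0 : on finset.set0 = setT.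
Proof. by apply/seteqP; split=> // p _ i; rewrite inE. Qed.

Lemma setI_onU1 W k B :
  W `&` on (k |: B)%SET = W `&` hyperplane A k `&` on B.
Proof.
apply/seteqP; split=> p.
  case=> Wp pB; split; first by split=> //; apply/hyperplaneE/pB/setU11.
  by move=> i iB; apply/pB/setU1r.
by case=> -[Wp /hyperplaneE pk] pB; split=> // i /setU1P[->|/pB].
Qed.

Lemma relopenI W k : relopen W -> relopen (W `&` hyperplane A k).
Proof. by rewrite -on1; apply: relopen_on. Qed.

Lemma not_sub W k : ~ W `<=` hyperplane A k -> exists2 p, W p & aff k p != 0.
Proof.
move=> /existsNP[p /not_implyP[Wp pk]]; exists p => //.
by apply/eqP => /hyperplaneE.
Qed.

(** A relatively open convex set that meets a hyperplane [H_k] without lying in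
    it has points on both sides of it near any of its points [p] on [H_k], so near
    that no hyperplane avoiding [p] is crossed. *)
Lemma straddle W k p q : relopen W -> W p -> W q ->
  aff k p = 0 -> aff k q != 0 ->
  exists u v, [/\ W u /\ W v, 0 < aff k u, aff k v < 0 &
    forall i, aff i p != 0 -> Num.sg (aff i u) = Num.sg (aff i p)
                           /\ Num.sg (aff i v) = Num.sg (aff i p)].
Proof.
move=> oW Wp Wq pk qk.
have [e1 e1_gt0 We] := oW p q Wp Wq.
have [e2 e2_gt0 sg_e] := sg_along_near p q.
pose e := Num.min 1 (Num.min e1 e2).
have e_gt0 : 0 < e by rewrite !lt_min ltr01 e1_gt0.
have [eL1 [eLe1 eLe2]] : e <= 1 /\ e <= e1 /\ e <= e2.
  by rewrite /e !ge_min !lexx !orbT.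
have [We0 We1] : W (along p q e) /\ W (along p q (- e)).
  by split; apply: We; apply/andP; split; lra.
have sg0 : forall i, aff i p != 0 ->
    Num.sg (aff i (along p q e)) = Num.sg (aff i p).
  by apply: sg_e; rewrite gtr0_norm.
have sg1 : forall i, aff i p != 0 ->
    Num.sg (aff i (along p q (- e))) = Num.sg (aff i p).
  by apply: sg_e; rewrite normrN gtr0_norm.
have := aff_along k p q e; have := aff_along k p q (- e).
rewrite pk subr0 !add0r => k1 k0.
move: qk; rewrite neq_lt => /orP[qk|qk].
  exists (along p q (- e)), (along p q e); split=> //; last by split; auto.
    by rewrite k1 mulNr oppr_gt0 pmulr_rlt0.
  by rewrite k0 pmulr_rlt0.
exists (along p q e), (along p q (- e)); split=> //; last by split; auto.
  by rewrite k0 pmulr_rgt0.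
by rewrite k1 mulNr oppr_lt0 pmulr_rgt0.
Qed.

Lemma crossing W k p q : relopen W -> W p -> W q ->
  aff k p < 0 -> 0 < aff k q ->
  exists t, [/\ 0 < t < 1, W (along p q t) & aff k (along p q t) = 0].
Proof.
move=> oW Wp Wq pk qk; have [e e_gt0 We] := oW p q Wp Wq.
have d_gt0 : 0 < aff k q - aff k p by lra.
exists (- aff k p / (aff k q - aff k p)).
have t01 : 0 < - aff k p / (aff k q - aff k p) < 1.
  by rewrite divr_gt0 ?ltr_pdivrMr //; lra.
split=> //; first by apply: We; case/andP: t01 => *; apply/andP; split; lra.
by rewrite aff_along mulfVK ?gt_eqF // addrN.
Qed.

(** * No-broken-circuit sets by deletion and restriction *)

(** When [W] is the whole space these are the no-broken-circuit sets of the
    central or affine arrangement [s], for the order in which the head of [s] is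
    the largest element: [S] qualifies if [W] meets the intersection of [S] and
    no hyperplane [j] of [s] contains the intersection of [W] with the members of
    [S] larger than [j]. The test on [W `<=` hyperplane A k] is this condition
    for [j = k], where the larger members of [S] have already been intersected
    with [W]. *)
Fixpoint nbc W s : seq {set I} :=
  if s is k :: s' then
    if `[< W `<=` hyperplane A k >] then [::]
    else nbc W s' ++ [seq (k |: T)%SET | T <- nbc (W `&` hyperplane A k) s']
  else if `[< W !=set0 >] then [:: finset.set0] else [::].

Lemma nbc_cons W k s S : S \in nbc W (k :: s) ->
  (exists2 p, W p & aff k p != 0) /\
  (S \in nbc W s \/
   exists2 S', S' \in nbc (W `&` hyperplane A k) s & S = (k |: S')%SET).
Proof.
rewrite /=; case: asboolP => // Wk; rewrite mem_cat => H; split.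
  exact: not_sub.
by case/orP: H => [|/mapP[S' ? ->]]; [left|right; exists S'].
Qed.

Lemma nbc_sub W s S : S \in nbc W s -> {subset S <= s}.
Proof.
elim: s W S => [|k s IH] W S.
  by rewrite /=; case: ifP => //= _; rewrite inE => /eqP-> i; rewrite inE.
move=> /nbc_cons[_ [/IH SS|[S' /IH SS ->]]] i.
  by move=> /SS; rewrite inE orbC => ->.
by rewrite !inE => /orP[->//|/SS ->]; rewrite orbT.
Qed.

Lemma nbc_meet W s S : S \in nbc W s -> W `&` on S !=set0.
Proof.
elim: s W S => [|k s IH] W S.
  rewrite /=; case: asboolP => [[p Wp]|//].
  by rewrite inE => /eqP ->; exists p; split=> // i; rewrite inE.
move=> /nbc_cons[_ [/IH //|[S' /IH [p [[Wp pk] pS]] ->]]].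
by exists p; split=> // i /setU1P[->|/pS //]; apply/hyperplaneE.
Qed.

Lemma nbc_mono W Y s : Y `<=` W -> {subset nbc Y s <= nbc W s}.
Proof.
elim: s W Y => [|k s IH] W Y YW S /=.
  case: asboolP => [[p /YW Wp]|_]; last by rewrite in_nil.
  by case: asboolP => // -[]; exists p.
case: asboolP => // Yk; case: asboolP => [Wk|_].
  by case: Yk; apply: subset_trans Wk.
rewrite !mem_cat => /orP[/(IH _ _ YW) ->//|/mapP[S' HS ->]].
apply/orP; right; apply: map_f; apply: IH HS; exact: setSI.
Qed.

(** Dropping [k] from a set that contains it leads from the restriction to the
    deletion, which is allowed by [nbc_mono]. *)
Lemma nbc_down W s S T : uniq s -> S \in nbc W s -> T \subset S -> T \in nbc W s.
Proof.
elim: s W S T => [|k s IH] W S T /=.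
  case: asboolP => // _ _; rewrite !inE => /eqP ->.
  by rewrite finset.subset0.
case/andP=> ks us; case: asboolP => // Wk.
rewrite !mem_cat => /orP[HS TS|/mapP[S' HS ->] TS].
  by rewrite (IH _ _ _ us HS TS).
have TS' : (T :\ k \subset S')%SET by rewrite finset.subDset.
have HT := IH _ _ _ us HS TS'.
have [kT|kT] := boolP (k \in T).
  by apply/orP; right; apply/mapP; exists (T :\ k)%SET => //; rewrite finset.setD1K.
have <- : (T :\ k)%SET = T.
  by apply/setP => i; rewrite !inE; case: eqP => // ->; rewrite (negPf kT).
by rewrite (nbc_mono _ HT) //; apply: subIsetl.
Qed.

Lemma nbc_notin W s S k : k \notin s -> S \in nbc W s -> k \notin S.
Proof. by move=> ks /nbc_sub Ss; apply: contra ks => /Ss. Qed.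

Lemma nbc_uniq W s : uniq s -> uniq (nbc W s).
Proof.
elim: s W => [|k s IH] W /=; first by case: ifP.
case/andP=> ks us; case: ifP => // _; rewrite cat_uniq IH //=.
apply/andP; split.
  apply/hasPn => _ /mapP[S HS ->]; apply/negP => /(nbc_notin ks).
  by rewrite setU11.
rewrite map_inj_in_uniq ?IH // => S T /(nbc_notin ks) kS /(nbc_notin ks) kT.
by move=> E; rewrite -(finset.setU1K kS) E finset.setU1K.
Qed.

Definition positive S p : bool := [forall i in S, 0 < aff i p].

Lemma eq_positive S p q : (forall i, i \in S -> Num.sg (aff i p) = Num.sg (aff i q)) ->
  positive S p = positive S q.
Proof.
move=> E; apply: eq_forallb_in => i iS.
by rewrite -sgr_gt0 E // sgr_gt0.
Qed.

(** By induction on [s]. Crossing [H_k] at a point of [W `&` H_k] changes only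
    the terms with [k \in S], so the jump of a vanishing combination is a
    vanishing combination on the restriction; once those coefficients are known
    to be zero, what is left is a combination on the deletion. *)
Lemma nbc_free W s (a : {set I} -> R) : uniq s -> relopen W ->
  (forall p, W p -> (forall j, j \in s -> aff j p != 0) ->
     \sum_(S <- nbc W s) a S * (positive S p)%:R = 0) ->
  forall S, S \in nbc W s -> a S = 0.
Proof.
elim: s W a => [|k s IH] W a /=.
  case: asboolP => // -[p Wp] _ _ /(_ p Wp) H S; rewrite inE => /eqP ->.
  move: H; rewrite big_seq1 => <-; last by move=> j.
  rewrite (_ : positive _ _ = true) ?mulr1 //.
  by apply/forall_inP => i; rewrite inE.
case/andP => ks us oW; case: asboolP => // /not_sub[r Wr rk] H.
have {}H p : W p -> (forall j, j \in s -> aff j p != 0) -> aff k p != 0 ->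
    \sum_(S <- nbc W s) a S * (positive S p)%:R +
    (\sum_(S <- nbc (W `&` hyperplane A k) s) a (k |: S)%SET * (positive S p)%:R)
       * (0 < aff k p)%R%:R = 0.
  move=> Wp ps pk; rewrite -[RHS](H p Wp); last first.
    by move=> j; rewrite inE => /orP[/eqP->//|/ps].
  rewrite big_cat big_map; congr (_ + _) => /=; rewrite mulr_suml.
  apply: eq_bigr => S _; rewrite -mulrA -natrM mulnb; congr (_ * _%:R).
  congr nat_of_bool; apply/andP/forall_inP => [[/forall_inP pS kS] i|pS].
    by move=> /setU1P[->//|/pS].
  split; last exact/pS/setU11.
  by apply/forall_inP => i iS; apply/pS/setU1r.
(* Near p no hyperplane of s is crossed, so these sums take the same value at
   p and at the points u next to it. *)
have HS p u X : (forall j, j \in s -> aff j p != 0) ->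
    (forall i, aff i p != 0 -> Num.sg (aff i u) = Num.sg (aff i p)) ->
    forall b : {set I} -> R,
    \sum_(S <- nbc X s) b S * (positive S u)%:R =
    \sum_(S <- nbc X s) b S * (positive S p)%:R.
  move=> ps sgE b; apply: eq_big_seq => S /nbc_sub Ss; congr (_ * _%:R).
  by congr nat_of_bool; apply: eq_positive => i /Ss /ps /sgE.
have off p u : (forall j, j \in s -> aff j p != 0) ->
    (forall i, aff i p != 0 -> Num.sg (aff i u) = Num.sg (aff i p)) ->
    (forall j, j \in s -> aff j u != 0).
  by move=> ps sgE j /ps pj; rewrite -sgr_eq0 sgE // sgr_eq0.
have a1 S : S \in nbc (W `&` hyperplane A k) s -> a (k |: S)%SET = 0.
  apply: (IH _ (fun S => a (k |: S)%SET) us); first exact: relopenI.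
  move=> p [Wp /hyperplaneE pk] ps.
  have [u [v [[Wu Wv] uk vk sgE]]] := straddle oW Wp Wr pk rk.
  have sgu i pi := (sgE i pi).1; have sgv i pi := (sgE i pi).2.
  have := H u Wu (off _ _ ps sgu) (lt0r_neq0 uk).
  have := H v Wv (off _ _ ps sgv) (ltr0_neq0 vk).
  rewrite uk (lt_gtF vk) !(HS _ _ _ ps sgu) !(HS _ _ _ ps sgv).
  by rewrite mulr0 mulr1 addr0 => ->; rewrite add0r.
have a0 S : S \in nbc W s -> a S = 0.
  apply: IH => // p Wp ps.
  have [u [Wu uk sgE]] : exists u, [/\ W u, aff k u != 0 &
      forall i, aff i p != 0 -> Num.sg (aff i u) = Num.sg (aff i p)].
    have [pk|pk] := eqVneq (aff k p) 0; last by exists p.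
    have [u [v [[Wu _] uk _ sgE]]] := straddle oW Wp Wr pk rk.
    by exists u; split=> [//||i /sgE[]//]; rewrite gt_eqF.
  rewrite -(HS _ _ _ ps sgE) -[RHS](H u Wu (off _ _ ps sgE) uk).
  rewrite [X in _ = _ + X * _]big1_seq ?mul0r ?addr0 //.
  by move=> X /= /a1 ->; rewrite mul0r.
by move=> X; rewrite mem_cat => /orP[/a0|/mapP[T /a1 + ->]].
Qed.

Definition patterns W s : {set {set I}} :=
  [set T | `[< exists2 p, W p /\ (forall j, j \in s -> aff j p != 0) &
                T = [set j in s | 0 < aff j p]%SET >]]%SET.

(** The upper half of the count of regions. A pattern for [s] extends to [k]
    with both signs only if its region has points on both sides of [H_k], hence
    by convexity meets [H_k], and so is also a pattern of the restriction to
    [H_k]. *)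
Lemma card_patterns W s : uniq s -> relopen W ->
  (#|patterns W s| <= size (nbc W s))%N.
Proof.
elim: s W => [|k s IH] W /=.
  case: asboolP => [_|W0] _ _; last first.
    rewrite leqn0 cards_eq0 -finset.subset0; apply/fintype.subsetP => T.
    by rewrite inE => /asboolP[p [Wp _] _]; case: W0; exists p.
  rewrite /= -(cards1 (@finset.set0 I)); apply/subset_leq_card/fintype.subsetP => T.
  rewrite inE => /asboolP[p _ ->].
  by apply/set1P/setP => i; rewrite !inE.
case/andP=> ks us oW; case: asboolP => Wk.
  rewrite leqn0 cards_eq0 -finset.subset0; apply/fintype.subsetP => T.
  rewrite inE => /asboolP[p [/Wk/hyperplaneE pk /(_ k)]].
  by rewrite mem_head pk eqxx => /(_ isT).
set P := patterns _ _.
pose P0 := [set T in P | k \notin T]%SET.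
pose P1 := [set (T :\ k)%SET | T in [set T in P | k \in T]%SET]%SET.
have cardP : #|P| = (#|P0 :|: P1| + #|P0 :&: P1|)%N.
  rewrite cardsUI card_in_imset => [|S T].
    rewrite addnC -(cardsID [set T : {set I} | k \in T]%SET P).
    by congr (_ + _)%N; apply: eq_card => T; rewrite !inE // andbC.
  by rewrite !inE => /andP[_ kS] /andP[_ kT] E; rewrite -(finset.setD1K kS) E finset.setD1K.
have PP p : [set j in k :: s | 0 < aff j p]%SET =
    (if (0 < aff k p)%R then k |: [set j in s | 0 < aff j p]
     else [set j in s | 0 < aff j p])%SET.
  case: ifP => pk; apply/setP => j; rewrite !inE.
    by case: eqP => [->|].
  by case: eqP => [->|//]; rewrite pk (negPf ks).
have kNT p : k \notin [set j in s | 0 < aff j p]%SET.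
  by rewrite inE (negPf ks).
have P0E T : T \in P0 -> exists p, [/\ W p, forall j, j \in s -> aff j p != 0,
    aff k p < 0 & T = [set j in s | 0 < aff j p]%SET].
  rewrite !inE => /andP[/asboolP[p [Wp ps] TE] kT]; exists p.
  have pk : ~~ (0 < aff k p).
    by apply: contra kT => pk; rewrite TE PP pk setU11.
  split=> //; first by move=> j js; apply: ps; rewrite inE js orbT.
    by rewrite lt_neqAle ps ?mem_head //= leNgt.
  by rewrite TE PP (negPf pk).
have P1E T : T \in P1 -> exists p, [/\ W p, forall j, j \in s -> aff j p != 0,
    0 < aff k p & T = [set j in s | 0 < aff j p]%SET].
  move=> /imsetP[T']; rewrite !inE => /andP[/asboolP[p [Wp ps] T'E] kT'] ->.
  exists p; have pk : 0 < aff k p.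
    by move: kT'; rewrite T'E PP; case: ifP => // _; rewrite (negPf (kNT p)).
  split=> //; first by move=> j js; apply: ps; rewrite inE js orbT.
  by rewrite T'E PP pk finset.setU1K // kNT.
rewrite cardP size_cat size_map leq_add //.
  apply: leq_trans (IH W us oW); apply/subset_leq_card/fintype.subsetP => T.
  by case/finset.setUP=> [/P0E|/P1E] [p [Wp ps _ TE]]; rewrite inE; apply/asboolP; exists p.
apply: leq_trans (IH _ us (relopenI (k := k) oW)).
apply/subset_leq_card/fintype.subsetP => T.
move=> /finset.setIP[/P0E [p [Wp ps pk Tp]] /P1E [q [Wq qs qk Tq]]].
have [t [t01 Wt tk]] := crossing oW Wp Wq pk qk.
have pos j : j \in s -> (0 < aff j p) = (0 < aff j q).
  by move=> js; move: (congr1 (fun X : {set I} => j \in X) (etrans (esym Tp) Tq));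
     rewrite !inE js.
have sgt j : j \in s -> (aff j (along p q t) != 0) /\
    (0 < aff j (along p q t)) = (0 < aff j p).
  move=> js; rewrite aff_along; have := pos j js.
  have := qs _ js; have := ps _ js; rewrite !neq_lt; case/andP: t01 => t0 t1.
  case/orP=> jp; case/orP=> jq; rewrite ?jp ?jq ?(lt_gtF jp) ?(lt_gtF jq) // => _.
    have neg : aff j p + t * (aff j q - aff j p) < 0 by nra.
    by rewrite neg (lt_gtF neg).
  have neg : aff j p + t * (aff j q - aff j p) > 0 by nra.
  by rewrite neg orbT.
rewrite inE; apply/asboolP; exists (along p q t).
  by split; [split=> //; apply/hyperplaneE|move=> j /sgt[]].
by rewrite Tp; apply/setP => j; rewrite !inE; case: (boolP (j \in s)) => // /sgt[_ ->].
Qed.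

(** If [Y] lies in [H_k], the deletion and the restriction contribute the same
    sum with opposite signs; if not, only the deletion contributes. *)
Lemma nbc_alternating W Y s : Y !=set0 -> Y `<=` W -> uniq s ->
  \sum_(S <- nbc W s | `[< Y `<=` on S >]) (-1) ^+ #|S| =
  (~~ has (fun k => `[< Y `<=` hyperplane A k >]) s)%:R :> int.
Proof.
elim: s W => [|k s IH] W Y0 YW /=.
  move=> _; case: asboolP => [_|[]]; last by case: Y0 => p /YW Wp; exists p.
  rewrite big_mkcond big_seq1 cards0 expr0; case: asboolP => // -[] p _ i.
  by rewrite inE.
case/andP=> ks us; case: (asboolP (W `<=` _)) => Wk.
  rewrite big_nil; case: asboolP => [_|[]]; first by [].
  exact: subset_trans Wk.
rewrite big_cat IH //= big_map; case: (asboolP (Y `<=` _)) => Yk /=; last first.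
  rewrite big1 ?addr0 // => S /asboolP YS; case: Yk => p /YS pS.
  exact/hyperplaneE/pS/setU11.
rewrite (eq_bigl (fun S => `[< Y `<=` on S >])); last first.
  move=> S; apply/asboolP/asboolP => YS p Yp i.
    by move=> iS; apply: YS => //; apply: setU1r.
  by move=> /setU1P[->|/(YS _ Yp)//]; apply/hyperplaneE/Yk.
rewrite big_seq_cond (eq_bigr (fun S : {set I} => - (-1) ^+ #|S|)); last first.
  move=> S /andP[/(nbc_notin ks) kS _].
  by rewrite cardsU1 kS exprS mulN1r.
rewrite -big_seq_cond sumrN IH ?subrr //.
by move=> p Yp; split; [exact: YW|exact: Yk].
Qed.

(** The exchange property of the matroid of hyperplane sections of [W]: a
    nonempty section by [H_k] that lies in [H_j] is the whole section by [H_j].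
    Were there a point of [W `&` H_j] off [H_k], one such point [u] could be
    taken on the side of [H_k] opposite to a given point [r] of [W] off [H_j];
    the segment from [u] to [r] then crosses [H_k] at a point that is not in
    [H_j]. *)
Lemma hyperplane_exchange W j k : relopen W -> W `&` hyperplane A k !=set0 ->
  W `&` hyperplane A k `<=` hyperplane A j -> ~ W `<=` hyperplane A j ->
  W `&` hyperplane A j `<=` hyperplane A k.
Proof.
move=> oW [p [Wp pk]] kj /not_sub[r Wr rj] q [Wq /hyperplaneE qj].
apply: contrapT => qk.
have {}kj x : W x -> aff k x = 0 -> aff j x = 0.
  by move=> Wx xk; apply/hyperplaneE/kj; split=> //; apply/hyperplaneE.
move/hyperplaneE: pk => pk; have pj := kj _ Wp pk.
have {}qk : aff k q != 0 by apply/eqP => /hyperplaneE.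
have rk : aff k r != 0 by apply: contra_neq rj => /kj; apply.
have [e e_gt0 We] := oW p q Wp Wq.
have [u [v [[Wu uj] [Wv vj] uk vk]]] : exists u v, [/\ W u /\ aff j u = 0,
    W v /\ aff j v = 0, 0 < aff k u & aff k v < 0].
  have [Wm jm km] : [/\ W (along p q (- e)), aff j (along p q (- e)) = 0 &
       aff k (along p q (- e)) = - e * aff k q].
    split; first by apply: We; apply/andP; split; lra.
      by rewrite aff_along pj qj; ring.
    by rewrite aff_along pk; ring.
  move: qk; rewrite neq_lt => /orP[qk|qk].
    by exists (along p q (- e)), q; split=> //; rewrite km; nra.
  by exists q, (along p q (- e)); split=> //; rewrite km; nra.
suff [t [t0 t1]] : exists t, t != 0 /\ t * aff j r = 0.
  by move/eqP: t1; rewrite mulf_eq0 (negPf t0) (negPf rj).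
move: rk; rewrite neq_lt => /orP[rk|rk].
  have [t [/andP[t0 t1] Wt tk]] := crossing oW Wr Wu rk uk.
  exists (1 - t); split; first by rewrite subr_eq0 gt_eqF.
  by have := kj _ Wt tk; rewrite aff_along uj => <-; ring.
have [t [/andP[t0 t1] Wt tk]] := crossing oW Wv Wr vk rk.
exists t; split; first by rewrite gt_eqF.
by have := kj _ Wt tk; rewrite aff_along vj => <-; ring.
Qed.

(** Every nonempty intersection has a no-broken-circuit basis. The largest
    hyperplane [k] is kept only if necessary: if the section of [W] by [H_k]
    lies in some smaller [H_j], exchange replaces [k] by [j]; otherwise the
    restriction to [H_k] satisfies the induction hypothesis. *)
Lemma nbc_exists W s B : uniq s -> relopen W ->
  (forall j, j \in s -> ~ W `<=` hyperplane A j) ->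
  {subset B <= s} -> W `&` on B !=set0 ->
  exists2 S, S \in nbc W s & W `&` on S = W `&` on B.
Proof.
elim: s W B => [|k s IH] W B /=.
  move=> _ _ _ Bs [p [Wp pB]]; case: asboolP => [_|[]]; last by exists p.
  exists finset.set0; first by rewrite inE.
  suff -> : B = finset.set0 by [].
  by apply/setP => i; rewrite inE; apply/negP => /Bs.
case/andP=> ks us oW Ws Bs B0.
have Wk := Ws k (mem_head _ _).
have {}Ws j : j \in s -> ~ W `<=` hyperplane A j.
  by move=> js; apply: Ws; rewrite inE js orbT.
case: (asboolP (W `<=` hyperplane A k)) => // _.
have take0 B' : {subset B' <= s} -> W `&` on B' = W `&` on B ->
    exists2 S, S \in nbc W s ++
        [seq (k |: T)%SET | T <- nbc (W `&` hyperplane A k) s]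
      & W `&` on S = W `&` on B.
  move=> B's BB'; have [|S HS SB] := IH W B' us oW Ws B's; first by rewrite BB'.
  by exists S; rewrite ?mem_cat ?HS // SB.
have [kB|kB] := boolP (k \in B); last first.
  apply: (take0 B) => // i iB; move: (Bs i iB).
  by rewrite inE; case: eqP => // ik; rewrite -ik iB in kB.
have BDs : {subset (B :\ k)%SET <= s}.
  by move=> i /setD1P[ik /Bs]; rewrite inE (negPf ik).
have BE : W `&` on B = W `&` hyperplane A k `&` on (B :\ k)%SET.
  by rewrite -setI_onU1 finset.setD1K.
have [[j js kj]|Nj] := pselect (exists2 j, j \in s &
    W `&` hyperplane A k `<=` hyperplane A j).
  have Wk0 : W `&` hyperplane A k !=set0.
    by case: B0 => p; rewrite BE => -[? _]; exists p.
  have jk := hyperplane_exchange oW Wk0 kj (Ws j js).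
  have WE : W `&` hyperplane A k = W `&` hyperplane A j.
    by apply/seteqP; split=> p Wp; split; case: (Wp) => // ? _; auto.
  apply: (take0 (j |: (B :\ k))%SET).
    by move=> i /setU1P[->//|/BDs].
  by rewrite BE WE setI_onU1.
have [|||S HS SE] := IH (W `&` hyperplane A k) (B :\ k)%SET us _ _ BDs.
- exact: relopenI.
- by move=> j js kj; apply: Nj; exists j.
- by rewrite -BE.
exists (k |: S)%SET; first by rewrite mem_cat map_f ?orbT.
by rewrite setI_onU1 SE -BE.
Qed.

End Geometry.

(** * Independence of no-broken-circuit sets *)

Section Rank.
Context {R : realType} {n : nat} {I : finType}.
Variable A : arrangement R n I.
Local Notation V := 'rV[R]_n.
Local Open Scope classical_set_scope.
Implicit Types (i j k : I) (p q r : V) (W : set V) (s : seq I) (S T B : {set I}).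

Definition span S : 'M[R]_n := (\sum_(i in S) <<normal A i>>)%MS.

Lemma aff_sub i p q : normal A i *m (q - p)^T = (aff A i q - aff A i p)%:M.
Proof.
apply/matrixP => a b; rewrite !ord1 !mxE eqxx mulr1n /aff.
rewrite opprB addrA subrK -sumrB; apply: eq_bigr => j _.
by rewrite !mxE mulrBr.
Qed.

Lemma span_aff S k p q : on A S p -> on A S q -> (normal A k <= span S)%MS ->
  aff A k p = aff A k q.
Proof.
move=> Sp Sq Sk; suff : (normal A k <= kermx (q - p)^T)%MS.
  move=> /sub_kermxP; rewrite aff_sub => /matrixP/(_ 0 0).
  by rewrite !mxE eqxx mulr1n => /subr0_eq.
apply: submx_trans Sk _; apply/sumsmx_subP => i iS; rewrite genmxE.
apply/sub_kermxP; rewrite aff_sub Sp // Sq // subrr.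
by apply/matrixP => a b; rewrite !mxE mul0rn.
Qed.

Lemma mulmx_col (u : 'rV[R]_n) (C : 'M_n) (j : 'I_n) :
  (u *m C) 0 j = (u *m col j C) 0 0.
Proof. by rewrite !mxE; apply: eq_bigr => i _; rewrite mxE. Qed.

(** A normal outside the span is detected by a vector orthogonal to the span but
    not to it, and moving along that vector stays in the flat and leaves the
    hyperplane. *)
Lemma span_on S k p : on A S p -> on A S `<=` hyperplane A k ->
  (normal A k <= span S)%MS.
Proof.
move=> Sp Sk; rewrite submxE; apply/eqP/matrixP => a j; rewrite ord1 {a}.
pose v := col j (cokermx (span S)).
have nv i : (normal A i *m v) 0 0 = aff A i (p + v^T) - aff A i p.
  have := aff_sub i p (p + v^T); rewrite [p + _]addrC addrK trmxK => ->.
  by rewrite mxE eqxx mulr1n.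
have vk : (normal A k *m cokermx (span S)) 0 j = (normal A k *m v) 0 0.
  exact: mulmx_col.
have pk : aff A k p = 0 by apply/hyperplaneE/Sk.
suff qS : on A S (p + v^T).
  by rewrite vk nv pk subr0 mxE; apply/hyperplaneE/Sk.
move=> i iS; have := nv i; rewrite (Sp i iS) subr0 => <-.
have iS' : (normal A i <= span S)%MS.
  by rewrite -(genmxE (normal A i)); apply: (sumsmx_sup i).
have nC : normal A i *m cokermx (span S) = 0 by apply/eqP; rewrite -submxE.
by rewrite -mulmx_col nC [LHS]mxE.
Qed.

Lemma rank_spanU1 B k : ~~ (normal A k <= span B)%MS ->
  \rank (span (k |: B)) = (\rank (span B)).+1.
Proof.
move=> kB.
have kNB : k \notin B.
  apply: contra kB => kB; rewrite -(genmxE (normal A k)).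
  exact: (sumsmx_sup k).
have E : span (k |: B) = (<<normal A k>> + span B)%MS by rewrite /span big_setU1.
apply/eqP; rewrite eqn_leq; apply/andP; split.
  rewrite E (leq_trans (mxrank_adds_leqif _ _)) // mxrank_gen -(addn1 (\rank (span B))).
  by rewrite addnC leq_add2l rank_leq_row.
rewrite rank_ltmx // /ltmx E addsmxSr /=; apply: contra kB => kB.
rewrite -(genmxE (normal A k)); apply: submx_trans kB; exact: addsmxSl.
Qed.

(** Each hyperplane met in the recursion cuts [W `&` on A B] properly and without
    making it empty, hence increases the rank by exactly one. *)
Lemma nbc_rank W B s S : uniq s -> S \in nbc A (W `&` on A B) s ->
  \rank (span (B :|: S)) = (\rank (span B) + #|S|)%N.
Proof.
elim: s B S => [|k s IH] B S /=.
  case: ifP => // _ _; rewrite inE => /eqP ->.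
  by rewrite finset.setU0 cards0 addn0.
case/andP=> ks us /nbc_cons[[p [Wp pB] pk] [/IH->//|[S' HS ->]]].
have [q [[[Wq qB] /hyperplaneE qk] _]] := nbc_meet HS.
have kB : ~~ (normal A k <= span B)%MS.
  by apply: contra_neqN pk => /(span_aff pB qB) ->.
rewrite setIAC -setI_onU1 in HS; have kS' := nbc_notin ks HS.
by rewrite cardsU1 kS' finset.setUCA finset.setUA IH // rank_spanU1 // addSnnS.
Qed.

Lemma eq_on_rank S T p : on A S p -> on A S = on A T ->
  \rank (span S) = \rank (span T).
Proof.
move=> Sp ST; apply/eqP; rewrite eqn_leq; apply/andP.
split; apply/mxrankS/sumsmx_subP => i ie; rewrite genmxE; apply: (@span_on _ _ p).
- by rewrite -ST.
- by rewrite -ST => x xS; apply/hyperplaneE/xS.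
- by [].
- by rewrite ST => x xS; apply/hyperplaneE/xS.
Qed.
End Rank.

(** * Flats meeting the open cone, and the Moebius function *)

Section Flats.
Context {R : realType} {n : nat} {I : finType}.
Variable A : arrangement R n I.
Variable J : {set I}.
Local Notation V := 'rV[R]_n.
Local Open Scope classical_set_scope.
Implicit Types (i j k : I) (p q r : V) (W : set V) (s : seq I) (S T B : {set I}).
Implicit Types (X Y Z : flat A) (F G : face A).

Definition cone : set V := [set p | forall i, i \in J -> 0 < aff A i p].

Lemma cone_near p q : cone p ->
  exists2 e : R, 0 < e & forall t, `|t| <= e -> cone (along p q t).
Proof.
move=> Up; have [e e_gt0 sgE] := sg_along_near A p q.
exists e => // t te i iJ; rewrite -sgr_gt0 sgE ?sgr_gt0 ?Up //.
by rewrite gt_eqF ?Up.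
Qed.

Lemma relopen_cone : relopen cone.
Proof.
move=> p q Up Uq; have [e e_gt0 Ue] := cone_near q Up.
exists e => // t /andP[te t1]; have [t0|t0] := lerP t 0.
  by apply: Ue; rewrite ler0_norm //; lra.
move=> i iJ; rewrite aff_along; have := Up i iJ; have := Uq i iJ; nra.
Qed.

(** A flat is determined by its trace on an open set that it meets. *)
Lemma cone_on_sub S k : cone `&` on A S !=set0 ->
  cone `&` on A S `<=` hyperplane A k -> on A S `<=` hyperplane A k.
Proof.
move=> [p [Up Sp]] Sk q Sq; have [e e_gt0 Ue] := cone_near q Up.
have pk : aff A k p = 0 by apply/hyperplaneE/Sk.
have ek : aff A k (along p q e) = 0.
  apply/hyperplaneE/Sk; split; first by apply: Ue; rewrite gtr0_norm.
  by move=> i iS; rewrite aff_along Sp // Sq // subrr mulr0 addr0.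
apply/hyperplaneE; move/eqP: ek; rewrite aff_along pk add0r subr0 mulf_eq0.
by rewrite gt_eqF //= => /eqP.
Qed.

(** Finitely many proper sections of a relatively open set are avoided one after
    the other, each time by a move that leaves the signs already fixed. *)
Lemma generic_point W s : relopen W -> W !=set0 -> exists2 p, W p &
  forall j, j \in s -> ~ W `<=` hyperplane A j -> aff A j p != 0.
Proof.
move=> oW W0; elim: s => [|k s [p Wp ps]]; first by case: W0 => p Wp; exists p.
have [Wk|/not_sub[q Wq qk]] := pselect (W `<=` hyperplane A k).
  by exists p => // j; rewrite inE => /orP[/eqP->//|]; apply: ps.
have [pk|pk] := eqVneq (aff A k p) 0; last first.
  by exists p => // j; rewrite inE => /orP[/eqP->//|]; apply: ps.
have [u [v [[Wu _] uk _ sgE]]] := straddle oW Wp Wq pk qk.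
exists u => // j; rewrite inE => /orP[/eqP-> _|js Wj]; first by rewrite gt_eqF.
have pj := ps j js Wj.
by rewrite -sgr_eq0 (sgE j pj).1 sgr_eq0.
Qed.

Lemma bigcap_on S : \bigcap_(i in [set` S]) hyperplane A i = on A S.
Proof. by apply/seteqP; split=> p Sp i /= iS; apply/hyperplaneE/Sp. Qed.

(** The default value is only taken when the hyperplanes of [S] have no common
    point. *)
Definition flat_of S : flat A := odflt (whole A) (flat_of_index A S).

Lemma points_flat_of S : on A S !=set0 -> points (flat_of S) = on A S.
Proof.
move=> S0; rewrite /flat_of /flat_of_index.
have HS : `[< is_flat A (\bigcap_(i in [set` S]) hyperplane A i) >].
  by apply/asboolP; split; [rewrite bigcap_on|exists S].
by rewrite (insubT (fun Q : set V => `[< is_flat A Q >]) HS) /= bigcap_on.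
Qed.

Lemma points_index X : points X = on A (flat_index X).
Proof.
have := flat_indexK X; rewrite /flat_of_index.
by case: insubP => //= Y _ + [YX]; rewrite YX bigcap_on.
Qed.

Definition sign_at p : {ffun I -> sign} :=
  [ffun i => if 0 < aff A i p then Plus else if aff A i p < 0 then Minus else Zero].

Lemma cellP (f : {ffun I -> sign}) p : cell A f p <-> f = sign_at p.
Proof.
have H i u : halfspace A i u p <-> u =
    (if 0 < aff A i p then Plus else if aff A i p < 0 then Minus else Zero).
  rewrite /aff subr_gt0 subr_lt0; case: u => /=; case: ltgtP => // pi; split=> // E.
    by rewrite E ltxx in pi.
  by rewrite E ltxx in pi.
split=> [fp|-> i _]; first by apply/ffunP => i; rewrite ffunE; apply/H/fp.
by rewrite ffunE; apply/H.
Qed.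

Lemma face_at_subproof p : `[< cell A (sign_at p) !=set0 >].
Proof. by apply/asboolP; exists p; apply/cellP. Qed.

Definition face_at p : face A := Face (face_at_subproof p).

Lemma face_atP F : exists p, F = face_at p.
Proof.
have /asboolP[p /cellP Fp] := face_neq0 F.
by exists p; apply: val_inj.
Qed.

Lemma face_at_eq0 p i : (face_at p i == Zero) = (aff A i p == 0).
Proof. by rewrite ffunE; case: ltgtP. Qed.

Lemma face_at_eqP p i : (face_at p i == Plus) = (0 < aff A i p).
Proof. by rewrite ffunE; case: ltgtP. Qed.

(** Conversely to the obvious direction, a flat that meets the cone is the
    support of the face of a generic point of its trace on the cone. *)
Lemma interior_flatsP X :
  reflect (points X `&` cone !=set0) (X \in interior_flats A J).
Proof.
apply: (iffP imsetP) => [[F FJ ->]|[p [Xp Up]]].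
  have [p FE] := face_atP F; exists p; split.
    by move=> i /= /eqP; rewrite FE face_at_eq0 => /eqP/hyperplaneE.
  move: FJ; rewrite inE => /andP[_ /forall_inP FJ] i iJ.
  by have := FJ i iJ; rewrite FE face_at_eqP.
have WX : cone `&` on A (flat_index X) !=set0 by exists p; rewrite -points_index.
have [q [Uq Xq] qI] := generic_point (enum I) (relopen_on (A:=A) (S := flat_index X) relopen_cone) WX.
exists (face_at q).
  rewrite !inE; apply/andP; split; apply/forall_inP => i iJ; rewrite face_at_eqP Uq //.
  by rewrite orbT.
apply: val_inj => /=; rewrite points_index; apply/seteqP; split=> x xX i.
  move=> /= /eqP; rewrite face_at_eq0 => qi.
  have [Xi|/(qI i)] := pselect (cone `&` on A (flat_index X) `<=` hyperplane A i).
    exact: (cone_on_sub WX Xi).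
  by rewrite mem_enum qi => /(_ isT).
move=> iX; apply/hyperplaneE/xX => /=.
by apply/eqP; rewrite face_at_eq0 Xq.
Qed.


Lemma hyperplane_proper k : ~ setT `<=` hyperplane A k.
Proof.
move=> H; have : normal A k != 0 := normal_neq0 A k.
case/rV0Pn => j; have aff0 p : aff A k p = 0 by apply/hyperplaneE/H.
have := aff_sub A k 0 (delta_mx 0 j); rewrite !aff0 !subr0 => /matrixP/(_ 0 0).
rewrite trmx_delta -colE !mxE eqxx mulr1n => ->.
by rewrite eqxx.
Qed.

Lemma flat_cone_sub Z S : points Z `&` cone !=set0 ->
  points Z `&` cone `<=` on A S -> points Z `<=` on A S.
Proof.
rewrite points_index setIC => Z0 ZS p Zp i iS.
apply/hyperplaneE; apply: (cone_on_sub Z0) Zp => x /ZS xS; exact/hyperplaneE/xS.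
Qed.

Lemma le_flat_of Z S : on A S !=set0 ->
  (Z <= flat_of S)%O = `[< points Z `<=` on A S >].
Proof. by move=> S0; rewrite leflatE points_flat_of. Qed.

Lemma points_whole : points (whole A) = setT.
Proof. by []. Qed.

Lemma le_whole Z : (Z <= whole A)%O.
Proof. by rewrite leflatE; apply/asboolP => p. Qed.

Local Notation nbcs := (nbc A cone (enum I)).

Lemma nbcs_on S : S \in nbcs -> on A S !=set0.
Proof. by move=> /nbc_meet[p [_ pS]]; exists p. Qed.

(** The alternating count, for [Y] the trace of [Z] on the cone: the only flat
    contained in no hyperplane is the whole space. *)
Lemma whole_eq_nbc Z : points Z `&` cone !=set0 ->
  (Z == whole A)%:R = \sum_(S <- nbcs | (Z <= flat_of S)%O) (-1) ^+ #|S| :> int.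
Proof.
move=> Z0; have ZU : points Z `&` cone `<=` cone by move=> p [].
have := nbc_alternating A Z0 ZU (enum_uniq I).
rewrite big_seq_cond (eq_bigl (fun S => (S \in nbcs) && (Z <= flat_of S)%O)).
  rewrite -big_seq_cond => ->; congr (nat_of_bool _)%:R.
  apply/eqP/hasPn => [-> k _|H].
    apply/asboolP; rewrite points_whole setTI -(setIT cone).
    rewrite -(on0 A) => /cone_on_sub; rewrite on0 => Hk; apply: (hyperplane_proper (k := k)).
    by apply: Hk; case: Z0 => p [_ Up]; exists p.
  apply: val_inj => /=; rewrite points_index; apply/seteqP; split=> // p _ i iZ.
  have /asboolP[] := H i (mem_enum _ i).
  by move=> q [+ _]; rewrite points_index => qZ; apply/hyperplaneE/qZ.
move=> S; case: (boolP (S \in nbcs)) => //= /nbcs_on S0.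
rewrite le_flat_of //; apply/asboolP/asboolP; first exact: flat_cone_sub.
by move=> ZS p [/ZS].
Qed.

(** Moebius inversion of [whole_eq_nbc]. *)
Lemma mobius_nbc X : X \in interior_flats A J ->
  mobius X (whole A) = \sum_(S <- nbcs | flat_of S == X) (-1) ^+ #|S|.
Proof.
move=> /interior_flatsP [p [Xp Up]].
have -> : mobius X (whole A) = \sum_(Z | (X <= Z)%O) mobius X Z * (Z == whole A)%:R.
  rewrite (bigD1 (whole A)) ?le_whole //= eqxx mulr1 big1 ?addr0 //.
  by move=> Z /andP[_ /negPf ->]; rewrite mulr0.
have -> : \sum_(Z | (X <= Z)%O) mobius X Z * (Z == whole A)%:R =
    \sum_(Z | (X <= Z)%O) \sum_(S <- nbcs | (Z <= flat_of S)%O)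
       mobius X Z * (-1) ^+ #|S|.
  apply: eq_bigr => Z XZ; rewrite whole_eq_nbc ?mulr_sumr //.
  by exists p; split=> //; move: XZ; rewrite leflatE => /asboolP; apply.
rewrite (exchange_big_dep predT) //= [RHS]big_mkcond; apply: eq_bigr => S _ /=.
rewrite -mulr_suml eq_sym; have [XS|XS] := boolP (X <= flat_of S)%O.
  by rewrite sum_mobius //; case: eqP; rewrite ?mul1r ?mul0r.
rewrite big_pred0 => [|Z].
  by rewrite mul0r; case: eqP => // XE; rewrite XE lexx in XS.
by apply/negP => /andP[XZ ZS]; rewrite (le_trans XZ ZS) in XS.
Qed.

Lemma nbcs_parity S T : S \in nbcs -> T \in nbcs -> flat_of S = flat_of T ->
  #|S| = #|T|.
Proof.
have rankE B : B \in nbcs -> \rank (span A B) = (\rank (span A finset.set0) + #|B|)%N.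
  move=> HB; rewrite -(@nbc_rank _ _ _ A cone finset.set0 (enum I)) ?enum_uniq //.
    by rewrite finset.set0U.
  by rewrite on0 setIT.
move=> HS HT E; have [p pS] := nbcs_on HS.
have ST : on A S = on A T.
  by rewrite -(points_flat_of (nbcs_on HS)) E points_flat_of //; apply: nbcs_on HT.
by have := eq_on_rank pS ST; rewrite (rankE _ HS) (rankE _ HT) => /addnI.
Qed.

Lemma mobius_count X : X \in interior_flats A J ->
  `|mobius X (whole A)|%N = count (fun S => flat_of S == X) nbcs.
Proof.
move=> XJ; rewrite mobius_nbc // -size_filter.
have [/eqP|] := posnP (size [seq S <- nbcs | flat_of S == X]).
  by rewrite size_eq0 => /eqP E; rewrite -big_filter E big_nil.
rewrite -has_predT => /hasP[T]; rewrite mem_filter => /andP[/eqP TX HT] _.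
rewrite big_seq_cond (eq_bigr (fun=> (-1) ^+ #|T|)) => [|S]; last first.
  by move=> /andP[HS /eqP SX]; rewrite (nbcs_parity HS HT) ?SX.
rewrite -big_seq_cond big_const_seq iter_addr_0 -size_filter.
by rewrite -mulr_natl abszM abszX /= exp1n muln1 natz.
Qed.

Lemma flat_of_interior S : S \in nbcs -> flat_of S \in interior_flats A J.
Proof.
move=> /nbc_meet[p [Up pS]]; apply/interior_flatsP; exists p; split=> //.
by rewrite points_flat_of //; exists p.
Qed.

Lemma interior_flat_nbc X : X \in interior_flats A J ->
  exists2 S, S \in nbcs & flat_of S = X.
Proof.
move=> /interior_flatsP[p [Xp Up]].
have X0 : cone `&` on A (flat_index X) !=set0.
  by exists p; rewrite -points_index.
have properU j : j \in enum I -> ~ cone `<=` hyperplane A j.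
  move=> _ Uj; apply: (hyperplane_proper (k := j)).
  by rewrite -(on0 A); apply: cone_on_sub; rewrite on0 setIT //; exists p.
have [|S HS SX] := nbc_exists (enum_uniq I) relopen_cone properU _ X0.
  by move=> i _; rewrite mem_enum.
exists S => //; apply: (val_inj : injective (@points _ _ _ A)).
apply/seteqP; split.
  rewrite (points_flat_of (nbcs_on HS)) points_index => x xS i iX.
  apply/hyperplaneE; apply: cone_on_sub xS; rewrite SX // => y [_ yX].
  exact/hyperplaneE/yX.
rewrite (points_flat_of (nbcs_on HS)); apply: flat_cone_sub; first by exists p.
by rewrite setIC points_index -SX => y [].
Qed.

End Flats.

(** * Linear algebra *)

(** If [Q] is a set of scalars containing all those at least [lam t], the product
    of the factors [P - r] for [r] in [Q] kills [M t]: the factor [r = lam t]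
    turns [M t] into a combination of matrices [M u] with [lam u > lam t], which
    the other factors kill by induction. *)
Lemma diagonalizable_increasing (R : realFieldType) (m : nat) (P : 'M[R]_m)
    (T : finType) (M : T -> 'M[R]_m) (lam : T -> R) (t0 : T) :
  M t0 = 1%:M ->
  (forall t, exists c : T -> R, P *m M t =
     lam t *: M t + \sum_(u | lam t < lam u) c u *: M u) ->
  diagonalizable P.
Proof.
case: m => [|m] in P M * => M0 PM; first by rewrite thinmx0; exact: diagonalizable0.
pose rs := undup (codom lam).
have killed t (Q : pred R) : (forall r, lam t <= r -> Q r) ->
    horner_mx P (\prod_(r <- rs | Q r) ('X - r%:P)) *m M t = 0.
  have [N] := ubnP #|[pred u | lam t < lam u]|.
  elim: N t Q => // N IH t Q; rewrite ltnS => tN tQ.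
  rewrite -big_filter (bigD1_seq (lam t)) ?filter_uniq ?undup_uniq //=; last first.
    by rewrite mem_filter tQ //= mem_undup codom_f.
  rewrite big_filter_cond mulrC rmorphM rmorphB /= horner_mx_X horner_mx_C.
  rewrite -mulmxE -mulmxA mulmxBl mul_scalar_mx; have [c ->] := PM t.
  rewrite addrAC subrr add0r mulmx_sumr big1 // => u tu.
  rewrite -scalemxAr IH ?scaler0 //.
    apply: leq_trans tN; apply: proper_card; apply/properP; split.
      by apply/fintype.subsetP => v; rewrite !inE; apply: lt_trans.
    by exists u; rewrite !inE ?ltxx.
  move=> r ur; have tr := lt_le_trans tu ur.
  by rewrite tQ ?ltW //= gt_eqF.
apply/diagonalizableP; exists rs; first exact: undup_uniq.
apply: mxminpoly_min; have := killed t0 predT (fun _ _ => isT).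
by rewrite M0 mulmx1.
Qed.

Lemma char_poly_conj (R : fieldType) (m : nat) (P Q B : 'M[R]_m) :
  B \in unitmx -> P *m B = B *m Q -> char_poly P = char_poly Q.
Proof.
rewrite unitmxE unitfE => B0 PB.
have cB0 : (\det B)%:P != 0 by rewrite polyC_eq0.
apply: (mulIf cB0); rewrite -det_map_mx -[RHS]mulrC /char_poly -!det_mulmx.
congr (\det _); rewrite /char_poly_mx mulmxBl mulmxBr -!map_mxM PB.
by rewrite scalar_mxC.
Qed.

(** * The random walk *)

Section Walk.
Context {R : realType} {n : nat} {I : finType}.
Variable A : arrangement R n I.
Variable J : {set I}.
Variable w : face A -> R.
Implicit Types (S T : {set I}) (F G D : face A) (f g : {ffun I -> sign}).

Local Notation chambers := (convex_chambers A J).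
Local Notation faces := (convex_faces A J).
Local Notation nbcs := (nbc A (cone A J) (enum I)).
Local Notation P := (transition J w).

Lemma mul_chamber G D : G \in faces -> D \in chambers -> (G * D)%g \in chambers.
Proof.
rewrite !inE => /forall_inP GJ /andP[/forallP Dc /forall_inP DJ].
apply/andP; split; first by apply/forallP => i; rewrite ffunE; case: ifP => // ->.
apply/forall_inP => i iJ; rewrite ffunE; have := GJ i iJ.
by case: eqP => // _ _; apply: DJ.
Qed.

Lemma smulA : associative (@smul I).
Proof.
by move=> f g h; apply/ffunP => i; rewrite !ffunE; case E: (f i == Zero) => //=; rewrite E.
Qed.

Lemma smulff f : smul f f = f.
Proof. by apply/ffunP => i; rewrite ffunE; case: ifP. Qed.

Lemma smul_absorb f g : (smul f g == f) = [forall i, (f i == Zero) ==> (g i == Zero)].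
Proof.
apply/eqP/forallP => [E i|H].
  apply/implyP => fi; move/ffunP/(_ i): E.
  by rewrite ffunE fi => ->.
by apply/ffunP => i; rewrite ffunE; case: eqP => // fi;
   have := H i; rewrite fi => /eqP.
Qed.

Definition act_mx f : 'M[R]_#|chambers| :=
  \matrix_(a, b) (smul f (enum_val a : face A) == (enum_val b : face A))%:R.

(** The row of [act_mx G] at [a] is the indicator of the chamber [G * D_a]; faces
    of the convex set map its chambers to one another. *)
Lemma sum_act_mx G (h : face A -> R) (a : 'I_#|chambers|) : G \in faces ->
  \sum_b act_mx G a b * h (enum_val b) = h (G * enum_val a)%g.
Proof.
move=> GJ; have Da := mul_chamber GJ (enum_valP a).
rewrite (bigD1 (enum_rank_in Da (G * enum_val a)%g)) //= mxE enum_rankK_in //.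
rewrite eqxx mul1r big1 ?addr0 // => c /negPf cE; rewrite mxE.
case: eqP => [E|_]; last by rewrite mul0r.
case/eqP: cE; apply: enum_val_inj; rewrite enum_rankK_in //.
by apply: val_inj; rewrite /= -E.
Qed.

Lemma act_mxM f G : G \in faces -> act_mx G *m act_mx f = act_mx (smul f G).
Proof.
move=> GJ; apply/matrixP => a b; rewrite !mxE -smulA.
rewrite -(sum_act_mx (fun D => (smul f D == (enum_val b : face A))%:R) a GJ).
by apply: eq_bigr => c _; rewrite [act_mx f _ _]mxE.
Qed.

Lemma transition_act : P = \sum_(G in faces) w G *: act_mx G.
Proof.
apply/matrixP => a b; rewrite summxE mxE big_mkcondr; apply: eq_bigr => G _.
by rewrite !mxE -(inj_eq val_inj) /=; case: eqP; rewrite ?mulr1 ?mulr0.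
Qed.

(** The equation [f G = f] says that [G] lies on every hyperplane at which [f]
    vanishes. The vector [f] need not be the sign vector of a face: the zero
    vector, which is the unit, is one only for a central arrangement. *)
Definition absorbed f : R := \sum_(G in faces | smul f G == f) w G.

(** A face absorbed by [f] is absorbed by [f G], and [G] is absorbed by [f G]
    but not by [f]. *)
Lemma absorbed_lt f G : (forall H, H \in faces -> 0 <= w H) ->
  G \in faces -> w G != 0 -> smul f G != f -> absorbed f < absorbed (smul f G).
Proof.
move=> w0 GJ wG fG; rewrite [ltRHS](bigD1 G) /=; last first.
  by rewrite GJ -smulA smulff eqxx.
rewrite [ltLHS]/absorbed -[ltLHS]add0r ltr_leD //; first by rewrite lt_neqAle eq_sym wG w0.
rewrite big_mkcond [leRHS]big_mkcond /=; apply: ler_sum => H _.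
case: (boolP (H \in faces)) => //= HJ; have wH := w0 _ HJ.
have [fH|_] := boolP (smul f H == f); last by case: ifP.
have HG : H != G by apply: contra fG => /eqP <-.
rewrite HG andbT ifT // smul_absorb; apply/forallP => i; apply/implyP.
move: fH; rewrite smul_absorb => /forallP/(_ i)/implyP fH.
by rewrite ffunE; case: ifP => [/fH|->].
Qed.

Lemma transition_diagonalizable : (forall H, H \in faces -> 0 <= w H) ->
  diagonalizable P.
Proof.
move=> w0; apply: (@diagonalizable_increasing _ _ _ _ act_mx absorbed [ffun=> Zero]).
  apply/matrixP => a b; rewrite !mxE; congr (nat_of_bool _)%:R.
  rewrite -(inj_eq enum_val_inj) -(inj_eq val_inj) /=; congr (_ == _).
  by apply/ffunP => i; rewrite !ffunE.
move=> f; exists (fun g => \sum_(G in faces | (smul f G != f) && (smul f G == g)) w G).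
rewrite {1}transition_act mulmx_suml (bigID (fun G => smul f G == f)) /=.
congr (_ + _).
  rewrite scaler_suml; apply: eq_bigr => G /andP[GJ /eqP fG].
  by rewrite -scalemxAl act_mxM // fG.
rewrite [RHS](eq_bigr _ (fun g _ => scaler_suml _ _ _ _)).
rewrite (exchange_big_dep (fun G => (G \in faces) && (smul f G != f))) /=; last first.
  by move=> g G _ /and3P[-> ->].
apply: eq_bigr => G /andP[GJ fG]; rewrite -scalemxAl act_mxM //.
have [->|wG] := eqVneq (w G) 0.
  by rewrite scale0r big1 // => g _; rewrite scale0r.
rewrite (big_pred1 (smul f G)) // => g; rewrite GJ fG /= andbC eq_sym.
by case: eqP => //= ->; rewrite absorbed_lt.
Qed.


Definition plus_at S D : bool := [forall i in S, D i == Plus].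

Definition eval_mx (L : seq {set I}) k : 'M[R]_(k, #|chambers|) :=
  \matrix_(l, a) (plus_at (nth finset.set0 L l) (enum_val a))%:R.

Lemma chamber_point D : D \in chambers ->
  exists p, [/\ cone A J p, forall i, aff A i p != 0 & D = face_at A p].
Proof.
have [p ->] := face_atP D; rewrite inE => /andP[/forallP pc /forall_inP pJ].
exists p; split=> // i; last by rewrite -face_at_eq0.
by move=> /pJ; rewrite face_at_eqP.
Qed.

Lemma point_chamber p : cone A J p -> (forall i, aff A i p != 0) ->
  face_at A p \in chambers.
Proof.
move=> pJ pc; rewrite inE; apply/andP; split.
  by apply/forallP => i; rewrite face_at_eq0.
by apply/forall_inP => i iJ; rewrite face_at_eqP pJ.
Qed.

Lemma plus_at_point S p : plus_at S (face_at A p) = positive A S p.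
Proof. by apply: eq_forallb_in => i _; rewrite face_at_eqP. Qed.

Lemma sum_nth_ord (U : nmodType) (L : seq {set I}) k (F : {set I} -> U) :
  size L = k -> \sum_(S <- L) F S = \sum_(l < k) F (nth finset.set0 L l).
Proof. by move=> <-; rewrite (big_nth finset.set0) big_mkord. Qed.

Lemma eval_mx_free L k : perm_eq L nbcs -> size L = k -> row_free (eval_mx L k).
Proof.
move=> Ln Lk; have uL : uniq L by rewrite (perm_uniq Ln) nbc_uniq ?enum_uniq.
apply: inj_row_free => v v0.
pose a S := \sum_(l < k | nth finset.set0 L l == S) v 0 l.
have aE (l : 'I_k) : a (nth finset.set0 L l) = v 0 l.
  rewrite /a (big_pred1 l) // => l' /=.
  by rewrite nth_uniq ?Lk.
have a0 S : S \in nbcs -> a S = 0.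
  apply: (nbc_free (enum_uniq I) (@relopen_cone _ _ _ A J)) => p Up pc.
  have pc' i : aff A i p != 0 by apply: pc; rewrite mem_enum.
  have pD := point_chamber Up pc'.
  have /matrixP/(_ 0 (enum_rank_in pD (face_at A p))) := v0.
  rewrite !mxE -(perm_big _ Ln) (sum_nth_ord _ Lk) /= => v0p.
  rewrite -[RHS]v0p; apply: eq_bigr => l _.
  by rewrite aE !mxE enum_rankK_in // plus_at_point.
apply/rowP => l; rewrite mxE -aE; apply: a0.
by rewrite -(perm_mem Ln) mem_nth ?Lk.
Qed.

(** Linear independence of functions on the chambers gives one inequality and the
    count of sign patterns the other. *)
Lemma size_nbcs : size nbcs = #|chambers|.
Proof.
apply/eqP; rewrite eqn_leq; apply/andP; split.
  have := eval_mx_free (perm_refl _) (erefl (size nbcs)).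
  by rewrite /row_free => /eqP <-; apply: rank_leq_col.
apply: leq_trans _ (card_patterns A (enum_uniq I) (@relopen_cone _ _ _ A J)).
pose pos D : {set I} := [set i | D i == Plus]%SET.
have inj_pos : {in chambers &, injective pos}.
  move=> C D; rewrite !inE => /andP[/forallP Cc _] /andP[/forallP Dc _] CD.
  apply: val_inj; apply/ffunP => i; move/setP/(_ i): CD; rewrite !inE /=.
  by have := Cc i; have := Dc i; case: (C i) => //; case: (D i).
rewrite -(card_in_imset inj_pos); apply/subset_leq_card/fintype.subsetP => T.
case/imsetP => D /chamber_point[p [Up pc DE]] ->; rewrite inE; apply/asboolP.
exists p; first by split.
by apply/setP => i; rewrite !inE mem_enum /= DE face_at_eqP.
Qed.

Definition zeros G S : {set I} := [set i in S | G i == Zero]%SET.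

(** The signs of [G D] at the hyperplanes that do not contain [G] are those of
    [G]. *)
Lemma plus_at_mul S G D : plus_at S (G * D)%g =
  [forall i in S, G i != Minus] && plus_at (zeros G S) D.
Proof.
apply/forall_inP/andP => [H|[/forall_inP GS /forall_inP DS] i iS].
  split; apply/forall_inP => i.
    by move=> iS; have := H i iS; rewrite ffunE; case: (G i).
  rewrite inE => /andP[iS /eqP Gi].
  by have := H i iS; rewrite ffunE Gi.
rewrite ffunE; have := GS i iS; have := DS i; rewrite inE iS /=.
by case: (G i) => //= ->.
Qed.

(** By [plus_at_mul], the coefficient of [plus_at T] in the image of [plus_at S]
    under the transition matrix. *)
Definition coef T S : R :=
  \sum_(G in faces | (zeros G S == T) && [forall i in S, G i != Minus]) w G.

Lemma coef_sub T S : coef T S != 0 -> T \subset S.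
Proof.
apply: contraR => TS; rewrite /coef big_pred0 // => G; apply/negP.
case/and3P => _ /eqP E _; case/negP: TS; rewrite -E.
by apply/fintype.subsetP => i; rewrite inE => /andP[].
Qed.

Lemma coef_diag S : S \in nbcs -> coef S S = lambda J w (flat_of A S).
Proof.
move=> /nbcs_on S0; apply: eq_bigl => G; congr (_ && _).
rewrite points_flat_of //; apply/andP/asboolP => [[/eqP GS _] p pG i|GS].
  rewrite -GS inE => /andP[_ /eqP Gi]; apply/hyperplaneE.
  by have := pG i Logic.I; rewrite Gi.
have [p GE] := face_atP G.
have pG : cell A G p by rewrite GE; apply/cellP.
have Gi i : i \in S -> G i = Zero.
  by move=> iS; apply/eqP; rewrite GE face_at_eq0; apply/eqP/(GS p pG).
split; last by apply/forall_inP => i /Gi ->.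
by apply/eqP/setP => i; rewrite inE; case: (boolP (i \in S)) => //= /Gi ->.
Qed.

(** Subsets of no-broken-circuit sets are again of this kind, so the expansion of
    the image of a basis function only involves basis functions. *)
Lemma transition_eval L k (kL : size L = k) : perm_eq L nbcs ->
  P *m (eval_mx L k)^T = (eval_mx L k)^T *m
    \matrix_(l, m) coef (nth finset.set0 L l) (nth finset.set0 L m).
Proof.
move=> Ln; have uL : uniq L by rewrite (perm_uniq Ln) nbc_uniq ?enum_uniq.
apply/matrixP => a m; set S := nth finset.set0 L m.
have SL : S \in L by rewrite mem_nth ?kL.
transitivity (\sum_(G in faces) w G * (plus_at S (G * enum_val a)%g)%:R).
  rewrite transition_act mulmx_suml summxE; apply: eq_bigr => G GJ.
  rewrite -scalemxAl mxE; congr (_ * _).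
  rewrite -(sum_act_mx (fun D => (plus_at S D)%:R) a GJ) mxE.
  by apply: eq_bigr => c _; rewrite !mxE.
rewrite mxE; transitivity (\sum_(T <- L) (plus_at T (enum_val a))%:R * coef T S); last first.
  by rewrite (sum_nth_ord _ kL); apply: eq_bigr => l _; rewrite !mxE.
under [RHS]eq_bigr do rewrite mulr_sumr.
rewrite (exchange_big_dep (mem faces)) /=; last by move=> T G _ /andP[].
apply: eq_bigr => G GJ.
have ZL : zeros G S \in L.
  rewrite (perm_mem Ln); move: SL; rewrite (perm_mem Ln) => SN.
  apply: nbc_down (enum_uniq I) SN _.
  by apply/fintype.subsetP => i; rewrite inE => /andP[].
rewrite big_mkcond (bigD1_seq (zeros G S)) //= GJ eqxx /= big1_seq ?addr0.
  rewrite plus_at_mul; case: ifP => _ /=; last by rewrite mulr0.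
  by rewrite mulrC.
by move=> T /andP[/negPf TZ _]; rewrite eq_sym TZ.
Qed.

Lemma char_poly_transition : char_poly P =
  \prod_(X in interior_flats A J)
    ('X - (lambda J w X)%:P) ^+ `|mobius X (whole A)|%N.
Proof.
(* Listed by decreasing cardinality, a proper subset comes after the set, which
   makes the matrix lower triangular. *)
pose L := sort (fun S T => #|T| <= #|S|)%N nbcs.
have Ln : perm_eq L nbcs by rewrite perm_sort.
have Lk : size L = #|chambers| by rewrite size_sort size_nbcs.
have Lsorted : sorted (fun S T => #|T| <= #|S|)%N L.
  by apply: sort_sorted => S T; apply: leq_total.
have uL : uniq L by rewrite (perm_uniq Ln) nbc_uniq ?enum_uniq.
set Q := \matrix_(l < #|chambers|, m < #|chambers|)
  coef (nth finset.set0 L l) (nth finset.set0 L m).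
have -> : char_poly P = char_poly Q.
  apply: (@char_poly_conj _ _ _ _ (eval_mx L #|chambers|)^T).
    by rewrite unitmx_tr -row_free_unit eval_mx_free.
  exact: transition_eval.
have Qtrig : is_trig_mx Q.
  apply/is_trig_mxP => l m lm; rewrite mxE; apply/eqP; apply: contraTT lm => /coef_sub lm.
  rewrite -leqNgt leq_eqVlt; apply/orP; have [->|Nlm] := eqVneq l m; first by left.
  right; rewrite ltnNge; apply/negP => le_lm.
  have := sorted_leq_nth (fun _ _ _ H1 H2 => leq_trans H2 H1) (fun _ => leqnn _)
    finset.set0 Lsorted l m.
  rewrite !inE Lk !ltn_ord => /(_ isT isT le_lm) card_lm.
  have : nth finset.set0 L l == nth finset.set0 L m by rewrite eqEcard lm.
  by rewrite nth_uniq ?Lk // => /eqP/val_inj/eqP; rewrite (negPf Nlm).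
rewrite char_poly_trig //; under [LHS]eq_bigr do rewrite mxE.
rewrite -(big_mkord predT (fun l => 'X - (coef (nth finset.set0 L l) (nth finset.set0 L l))%:P)).
rewrite -Lk -(big_nth finset.set0 predT (fun S => 'X - (coef S S)%:P)) (perm_big _ Ln) /=.
rewrite big_seq (eq_bigr (fun S => 'X - (lambda J w (flat_of A S))%:P)); last first.
  by move=> S /coef_diag ->.
rewrite (partition_big (flat_of A) (mem (interior_flats A J))) /=; last first.
  by move=> S; apply: flat_of_interior.
apply: eq_bigr => X XJ; rewrite (mobius_count XJ).
rewrite (eq_bigr (fun=> 'X - (lambda J w X)%:P)); last by move=> S /andP[_ /eqP ->].
by rewrite -big_seq_cond big_const_seq iter_mulr_1.
Qed.

Lemma eigenvalue_transition X : X \in interior_flats A J ->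
  eigenvalue P (lambda J w X).
Proof.
move=> XJ; rewrite eigenvalue_root_char char_poly_transition (bigD1 X) //=.
have mu_gt0 : (0 < `|mobius X (whole A)|)%N.
  rewrite (mobius_count XJ) -has_count; have [S HS SX] := interior_flat_nbc XJ.
  by apply/hasP; exists S => //; rewrite SX.
by rewrite rootM -(prednK mu_gt0) root_exp_XsubC eqxx.
Qed.

End Walk.

Theorem theorem2 (R : realType) (n : nat) (I : finType)
    (A : arrangement R n I) (J : {set I}) (w : face A -> R) :
  convex_chambers A J != finset.set0 ->
  is_distribution J w ->
  [/\ diagonalizable (transition J w),
      forall X : flat A, X \in interior_flats A J ->
        eigenvalue (transition J w) (lambda J w X)
    & char_poly (transition J w) =
        \prod_(X in interior_flats A J)
          ('X - (lambda J w X)%:P) ^+ `|mobius X (whole A)|%N].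
Proof.
move=> _ [w_ge0 _]; split.
- exact: transition_diagonalizable.
- exact: eigenvalue_transition.
- exact: char_poly_transition.
Qed.
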